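(* Let $S$ be a system of $N$ qubits arranged on a line, let $\rho$ be a density operator on $S$ and $H$ a Hermitian operator (Hamiltonian) on $S$. Let $A$ be an ancilla register of one or more qubits initialized in the all-zero state $|0\rangle$, and set $\tilde\rho=|0\rangle\langle 0|\otimes\rho$ and $\tilde H=I\otimes H$ on $A\otimes S$. Let $\mathcal{G}=\mathcal{G}_A\cup\mathcal{G}_S=\{P_1,\dots,P_d\}$ be a finite set of Hermitian generators on $A\otimes S$, where the elements of $\mathcal{G}_A$ act jointly on $A$ and $S$ and the elements of $\mathcal{G}_S$ act only on $S$. Let $k$ be an integer with $1\le k-1\le N$. Assume that for every Pauli operator $P$ supported on $k-1$ adjacent qubits of $S$, and for every ancilla qubit in $A$, both $X\otimes P$ and $Y\otimes P$ belong to $\mathcal{G}_A$, where $X$ and $Y$ are the Pauli operators acting on that ancilla qubit. For $\vec\theta\in\mathbb{R}^d$ let $$E(\vec\theta)=\operatorname{Tr}\big(e^{-i\vec\theta\cdot\vec P}\,\tilde\rho\,e^{i\vec\theta\cdot\vec P}\,\tilde H\big),\qquad \vec\theta\cdot\vec P=\sum_{j=1}^d\theta_jP_j,$$ and let $K=(K_{jk})_{1\le j,k\le d}$ be the Hessian matrix $K_{jk}=\left.\frac{\partial^2}{\partial\theta_j\partial\theta_k}E(\vec\theta)\right|_{\vec\theta=0}$. Let $L$ be any operator acting on $k-1$ adjacent qubits of $S$ (extended by the identity to all of $S$), and let $\mathcal{L}(\sigma)=L\sigma L^\dagger-\frac12\{L^\dagger L,\sigma\}$. If $K\succeq 0$ (positive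 semidefinite), then $$\left.\frac{d}{dt}\operatorname{Tr}\big[e^{t\mathcal{L}}(\rho)\,H\big]\right|_{t=0}\ge 0.$$
   Context: All Hilbert spaces are finite-dimensional: an $n$-qubit system has Hilbert space $(\mathbb{C}^2)^{\otimes n}$. A Pauli operator is a tensor product of single-qubit operators from $\{I,X,Y,Z\}$; it is supported on a set of qubits if it acts as the identity on every qubit outside that set (it may also act as the identity on some or all qubits inside the set). $\{A,B\}=AB+BA$ denotes the anticommutator. The notation $X\otimes P$ means the operator acting as $X$ on the chosen ancilla qubit, as $P$ on $S$, and as the identity on any other ancilla qubits. $e^{t\mathcal{L}}$ is the exponential of the linear map $\mathcal{L}$ on operators on $S$. *)

(* Defs.v *)
From HB Require Import structures.
From mathcomp Require Import all_boot all_order all_algebra.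
From mathcomp Require Import all_classical all_reals all_analysis.
From mathcomp Require Import complex mxtens.

Set Implicit Arguments.
Unset Strict Implicit.
Unset Printing Implicit Defensive.

Import Order.TTheory GRing.Theory Num.Theory.
Import numFieldNormedType.Exports.

Local Open Scope classical_set_scope.
Local Open Scope ring_scope.
Local Open Scope complex_scope.
Local Open Scope sesquilinear_scope.

(* The computational basis of n qubits consists of the bit strings
   {ffun 'I_n -> 'I_2}; operators are matrices in that basis, whose row and
   column indices enumerate the bit strings. *)
Definition qdim (n : nat) : nat := #|{: {ffun 'I_n -> 'I_2}}|.

Lemma qdimE n : qdim n = (2 ^ n)%N.
Proof. by rewrite /qdim card_ffun !card_ord. Qed.

Definition bits n (x : 'I_(qdim n)) : {ffun 'I_n -> 'I_2} := enum_val x.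
Definition bindex n (f : {ffun 'I_n -> 'I_2}) : 'I_(qdim n) := enum_rank f.

(* theta is complex conjugation for complex matrices, the identity for real
   ones; positive semidefinite matrices are hermitian (resp. symmetric) by
   definition. *)
Definition psdmx (F : numFieldType) (theta : F -> F) n (M : 'M[F]_n) : Prop :=
  M \is hermitianmx n false theta /\
  forall v : 'rV[F]_n, 0 <= (v *m M *m v ^t theta) 0 0.

Section Exponentials.
Variables (F : numFieldType) (n : nat).

Definition expmx (A : 'M[F]_n) : 'M[F]_n :=
  limn (series (fun k => k`!%:R^-1 *: A ^+ k)).

(* exponential of a linear map on matrices, evaluated at sigma *)
Definition expsuper (T : 'M[F]_n -> 'M[F]_n) (sigma : 'M[F]_n) : 'M[F]_n :=
  limn (series (fun k => k`!%:R^-1 *: iter k T sigma)).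

End Exponentials.

Definition hessian (R : realType) d (f : 'rV[R]_d -> R) (x : 'rV[R]_d) :
    'M[R]_d :=
  \matrix_(j, k) 'D_('e_j) (fun y => 'D_('e_k) f y) x.

Inductive pauli := PauliI | PauliX | PauliY | PauliZ.

Section Quantum.
Variable R : realType.
Local Notation C := R[i].

Definition mx2 (a b c d : C) : 'M[C]_2 :=
  \matrix_(i, j) nth 0 (nth [::] [:: [:: a; b]; [:: c; d]] i) j.

Definition pauli_mx (p : pauli) : 'M[C]_2 :=
  match p with
  | PauliI => mx2 1 0 0 1
  | PauliX => mx2 0 1 1 0
  | PauliY => mx2 0 (- 'i) 'i 0
  | PauliZ => mx2 1 0 0 (- 1)
  end.

(* Entrywise form of the n-fold Kronecker product of the pauli_mx (s q). *)
Definition pauli_op n (s : 'I_n -> pauli) : 'M[C]_(qdim n) :=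
  \matrix_(x, y) \prod_(q < n) pauli_mx (s q) (bits x q) (bits y q).

Definition pauli_at n (p : pauli) (q : 'I_n) : 'M[C]_(qdim n) :=
  pauli_op (fun q' => if q' == q then p else PauliI).

(* e places m qubits on m consecutive sites of a line of n qubits. *)
Definition adjacent_sites m n (e : 'I_m -> 'I_n) : Prop :=
  exists i : nat, forall j : 'I_m, e j = (i + j)%N :> nat.

(* L acting on the qubits e 0, ..., e (m-1), tensored with the identity on all
   the others (e is meant to be injective). *)
Definition extend_id m n (e : 'I_m -> 'I_n) (L : 'M[C]_(qdim m)) :
    'M[C]_(qdim n) :=
  \matrix_(x, y)
    (L (bindex [ffun j => bits x (e j)]) (bindex [ffun j => bits y (e j)])
     * [forall q, (q \notin codom e) ==> (bits x q == bits y q)]%:R).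

Definition density_op n (rho : 'M[C]_n) : Prop :=
  psdmx Num.conj rho /\ \tr rho = 1.

(* |0...0><0...0| *)
Definition proj0 n : 'M[C]_(qdim n) :=
  delta_mx (bindex [ffun=> ord0]) (bindex [ffun=> ord0]).

Definition anticomm n (A B : 'M[C]_n) : 'M[C]_n := A *m B + B *m A.

Definition dissipator n (L sigma : 'M[C]_n) : 'M[C]_n :=
  L *m sigma *m L ^t* - 2^-1 *: anticomm (L ^t* *m L) sigma.

(* The trace below is real when P, rho and H are hermitian; Re only changes its
   type from C to R. *)
Definition energy n d (P : 'I_d -> 'M[C]_n) (rho H : 'M[C]_n)
    (theta : 'rV[R]_d) : R :=
  let G := \sum_(j < d) (theta 0 j)%:C *: P j in
  complex.Re (\tr (expmx (- 'i *: G) *m rho *m expmx ('i *: G) *m H)).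

End Quantum.

(* Main.v *)
(* Put G = X (x) L1 + Y (x) L2, where X and Y act on one ancilla qubit and
   L = L1 + i L2 with L1, L2 real combinations of the Pauli operators on the
   k - 1 sites (the real and imaginary parts of the Pauli coefficients of L).
   Then G = |0><1| (x) L^* + |1><0| (x) L on that qubit and G is a real
   combination, with coefficients v, of the generators.  To second order the
   energy along G is
     Tr ((G rho~ G - (1/2) {G^2, rho~}) H~),
   and since G maps the ancilla state |0> to |1> this equals Tr (D_L(rho) H),
   where D_L is the dissipator of L.  So v K v^T = 2 Tr (D_L(rho) H), and the
   right-hand side is twice the derivative of Tr (e^{tD_L}(rho) H) at 0. *)
Require Import Defs.
From HB Require Import structures.
From mathcomp Require Import all_boot all_order all_algebra.
From mathcomp Require Import all_classical all_reals all_analysis.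
From mathcomp Require Import complex mxtens.
From mathcomp Require Import ring lra.

Set Implicit Arguments.
Unset Strict Implicit.
Unset Printing Implicit Defensive.

Import Order.TTheory GRing.Theory Num.Theory.
Import numFieldNormedType.Exports.

Local Open Scope classical_set_scope.
Local Open Scope ring_scope.
Local Open Scope complex_scope.

(** * Entrywise norms *)

Section EntrywiseNorm.
Variable R : realType.
Local Notation C := R[i].

(** Unlike the modulus of [C], this takes its values in [R]; it is submultiplicative and bounds the
    real and imaginary parts separately. *)
Definition cabs (z : C) : R := `|complex.Re z| + `|complex.Im z|.

Lemma cabs_ge0 z : 0 <= cabs z.
Proof. by rewrite addr_ge0. Qed.

Lemma cabsD z w : cabs (z + w) <= cabs z + cabs w.
Proof.
case: z w => [a b] [c d]; rewrite /cabs /=.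
by have := ler_normD a c; have := ler_normD b d; lra.
Qed.

Lemma cabsM z w : cabs (z * w) <= cabs z * cabs w.
Proof.
case: z w => [a b] [c d]; rewrite /cabs /= mulrDl !mulrDr -!normrM.
by have := ler_normB (a * c) (b * d); have := ler_normD (a * d) (b * c); lra.
Qed.

Lemma cabsMr (r : R) z : cabs (r%:C * z) = `|r| * cabs z.
Proof.
by case: z => [a b]; rewrite /cabs /= !mul0r addr0 subr0 !normrM mulrDr.
Qed.

Lemma cabs_sum (I : Type) (r : seq I) (F : I -> C) :
  cabs (\sum_(i <- r) F i) <= \sum_(i <- r) cabs (F i).
Proof.
elim/big_rec2: _ => [|i y z _ le_zy]; first by rewrite /cabs /= normr0 addr0.
by rewrite (le_trans (cabsD _ _)) // lerD2l.
Qed.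

Lemma Re_sum (I : Type) (r : seq I) (F : I -> C) :
  complex.Re (\sum_(i <- r) F i) = \sum_(i <- r) complex.Re (F i).
Proof. by elim/big_rec2: _ => [//|i y [a b] _ <-]; case: (F i). Qed.

Lemma Im_sum (I : Type) (r : seq I) (F : I -> C) :
  complex.Im (\sum_(i <- r) F i) = \sum_(i <- r) complex.Im (F i).
Proof. by elim/big_rec2: _ => [//|i y [a b] _ <-]; case: (F i). Qed.

Lemma norm_cabs z : `|z| <= (cabs z)%:C.
Proof.
rewrite normc_def lecR /cabs -[leRHS]ger0_norm ?addr_ge0 // -sqrtr_sqr.
rewrite ler_wsqrtr // sqrrD !real_normK ?num_real // -addrA lerD2l lerDr.
by rewrite mulrn_wge0 ?mulr_ge0.
Qed.

Definition mxabs m n (A : 'M[C]_(m, n)) : R := \sum_i \sum_j cabs (A i j).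

Lemma mxabs_ge0 m n (A : 'M[C]_(m, n)) : 0 <= mxabs A.
Proof. by do 2?[apply: sumr_ge0 => ? _]; exact: cabs_ge0. Qed.

Lemma mxabs0 m n : mxabs (0 : 'M[C]_(m, n)) = 0.
Proof.
by do 2?[rewrite /mxabs big1 // => ? _]; rewrite mxE /cabs /= normr0 addr0.
Qed.

Lemma mxabsD m n (A B : 'M[C]_(m, n)) : mxabs (A + B) <= mxabs A + mxabs B.
Proof.
rewrite -big_split ler_sum // => i _; rewrite -big_split ler_sum // => j _.
by rewrite mxE cabsD.
Qed.

Lemma mxabsZ m n c (A : 'M[C]_(m, n)) : mxabs (c *: A) <= cabs c * mxabs A.
Proof.
rewrite mulr_sumr ler_sum // => i _; rewrite mulr_sumr ler_sum // => j _.
by rewrite mxE cabsM.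
Qed.

Lemma mxabsZr m n (r : R) (A : 'M[C]_(m, n)) :
  mxabs (r%:C *: A) = `|r| * mxabs A.
Proof.
rewrite mulr_sumr; apply: eq_bigr => i _; rewrite mulr_sumr.
by apply: eq_bigr => j _; rewrite mxE cabsMr.
Qed.

(** Each [cabs (B k j)] is enlarged to the sum of column [j] of [B], which decouples the two
    sums. *)
Lemma mxabsM m n p (A : 'M[C]_(m, n)) (B : 'M[C]_(n, p)) :
  mxabs (A *m B) <= mxabs A * mxabs B.
Proof.
rewrite mulr_suml ler_sum // => i _.
have -> : (\sum_j cabs (A i j)) * mxabs B =
  \sum_j (\sum_k cabs (A i k)) * (\sum_k cabs (B k j)).
  by rewrite -mulr_sumr /mxabs exchange_big.
rewrite ler_sum // => j _; rewrite mxE (le_trans (cabs_sum _ _)) //.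
rewrite mulr_suml ler_sum // => k _; rewrite (le_trans (cabsM _ _)) //.
rewrite ler_wpM2l ?cabs_ge0 // (bigD1 k) //= lerDl sumr_ge0 // => ? _.
exact: cabs_ge0.
Qed.

Lemma cabs_le_mxabs m n (A : 'M[C]_(m, n)) i j : cabs (A i j) <= mxabs A.
Proof.
rewrite /mxabs (bigD1 i) //= (bigD1 j) //= -addrA lerDl addr_ge0 //.
  by apply: sumr_ge0 => ? _; exact: cabs_ge0.
by do 2?[apply: sumr_ge0 => ? _]; exact: cabs_ge0.
Qed.

Lemma Re_trace_le n (A : 'M[C]_n) : `|complex.Re (\tr A)| <= mxabs A.
Proof.
have le_cabs z : `|complex.Re z| <= cabs z by rewrite /cabs lerDl.
rewrite (le_trans (le_cabs _)) // (le_trans (cabs_sum _ _)) // ler_sum // => i _.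
by rewrite (bigD1 i) //= lerDl sumr_ge0 // => ? _; exact: cabs_ge0.
Qed.

End EntrywiseNorm.

(** * Exponential series of matrices *)

Section ExponentialSeries.
Variables (R : realType) (n : nat).
Local Notation C := R[i].
Local Notation M := 'M[C]_n.
Implicit Types u v : nat -> M.

(** Stated on real and imaginary parts so that the theory of real series applies; [mxcvg_cvg]
    transfers it to the topology of the [limn] in [expmx] and [expsuper]. *)
Definition mxcvg (u : nat -> M) (l : M) : Prop := forall i j,
  complex.Re (u k i j) @[k --> \oo] --> complex.Re (l i j) /\
  complex.Im (u k i j) @[k --> \oo] --> complex.Im (l i j).

Lemma mxcvg_cvg (u : nat -> 'M[C : numFieldType]_n) (l : 'M[C : numFieldType]_n) :
  mxcvg u l -> u @ \oo --> l.
Proof.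
move=> ul; apply/cvg_ballP => e e0.
(* A positive radius in [C] is real, so it can be shared between the real and imaginary parts. *)
have {e e0} [e e0 ->] : exists2 r : R, 0 < r & e = r%:C.
  exists (complex.Re e); first by move: e0; rewrite ltcE /= => /andP[].
  by rewrite RRe_real ?gtr0_real.
suff H : \forall k \near \oo, forall i j,
    ball (l i j : C : numFieldType) e%:C (u k i j).
  by near=> k; split; [rewrite ltcR | exact: (near H k)].
apply: filter_forall => i; apply: filter_forall => j.
have [/cvgrPdist_lt/(_ (e / 2))+ /cvgrPdist_lt/(_ (e / 2))+] := ul i j.
rewrite divr_gt0 // => /(_ isT) re /(_ isT) im.
near=> k; rewrite /ball /= (le_lt_trans (norm_cabs _)) // ltcR [ltRHS]splitr.
have H1 : `|complex.Re (l i j) - complex.Re (u k i j)| < e / 2 by near: k.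
have H2 : `|complex.Im (l i j) - complex.Im (u k i j)| < e / 2 by near: k.
by rewrite /cabs; case: (l i j) (u k i j) H1 H2 => [a b] [c d]; exact: ltrD.
Unshelve. all: by end_near. Qed.

Lemma mxcvg_lim (u : nat -> 'M[C : numFieldType]_n) (l : 'M[C : numFieldType]_n) :
  mxcvg u l -> limn u = l.
Proof. by move=> /mxcvg_cvg; apply: cvg_lim; exact: norm_hausdorff. Qed.

Lemma mxcvgD u v l m : mxcvg u l -> mxcvg v m ->
  mxcvg (fun k => u k + v k) (l + m).
Proof.
have reD (x y : C) : complex.Re (x + y) = complex.Re x + complex.Re y.
  by case: x y => [? ?] [].
have imD (x y : C) : complex.Im (x + y) = complex.Im x + complex.Im y.
  by case: x y => [? ?] [].
move=> ul vm i j; have [? ?] := ul i j; have [? ?] := vm i j.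
split; under eq_fun do rewrite mxE ?reD ?imD; rewrite mxE ?reD ?imD;
  exact: cvgD.
Qed.

Lemma mxcvgZr (r : R) u l : mxcvg u l ->
  mxcvg (fun k => r%:C *: u k) (r%:C *: l).
Proof.
have reZ (x : C) : complex.Re (r%:C * x) = r * complex.Re x.
  by case: x => ? ? /=; rewrite mul0r subr0.
have imZ (x : C) : complex.Im (r%:C * x) = r * complex.Im x.
  by case: x => ? ? /=; rewrite mul0r addr0.
move=> ul i j; have [? ?] := ul i j.
split; under eq_fun do rewrite mxE ?reZ ?imZ; rewrite mxE ?reZ ?imZ;
  exact: cvgMr.
Qed.

Lemma mxabs_cvg u l :
  mxcvg u l -> (mxabs (u k) @[k --> \oo] --> mxabs l).
Proof.
move=> ul; apply: cvg_big => // [|i _]; first exact: add_continuous.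
apply: cvg_big => // [|j _]; first exact: add_continuous.
by have [? ?] := ul i j; apply: cvgD; exact: cvg_norm.
Qed.

(** Leaving [u] free lets one theory serve [expmx] (powers), [expsuper] (iterates) and the
    derivative of the exponential ([dexpr]). *)
Definition expsum (u : nat -> 'M[C : numFieldType]_n) : M :=
  limn (series (fun k => k`!%:R^-1 *: u k)).

Definition geobound (u : nat -> M) : Prop :=
  exists c K : R, [/\ 0 <= c, 0 <= K & forall k, mxabs (u k) <= c * K ^+ k].

Lemma invfact_real k : (k`!%:R^-1 : C) = (k`!%:R^-1)%:C.
Proof. by rewrite fmorphV /= rmorph_nat. Qed.

(** Dividing the geometric bound by [k!] gives the terms of the series of [c * expR K], whose
    partial sums increase to their limit. *)
Lemma mxabs_expsum_partial u (c K : R) : 0 <= c -> 0 <= K ->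
  (forall k, mxabs (u k) <= c * K ^+ k) ->
  forall m, \sum_(0 <= k < m) mxabs (k`!%:R^-1 *: u k) <= c * expR K.
Proof.
move=> c0 K0 uK m; apply: (@le_trans _ _ (c * series (exp_coeff K) m)).
  rewrite seriesEnat /= mulr_sumr ler_sum // => k _.
  rewrite invfact_real mxabsZr ger0_norm ?invr_ge0 ?ler0n //.
  by rewrite /exp_coeff /= mulrA [leRHS]mulrC ler_wpM2l ?invr_ge0 ?ler0n.
rewrite ler_wpM2l // /expR; apply: nondecreasing_cvgn_le.
  apply: nondecreasing_series => k _ _; exact: exp_coeff_ge0.
exact: is_cvg_series_exp_coeff.
Qed.

(** Real and imaginary parts of each entry converge absolutely by comparison; the matrix [S] of
    their limits is [expsum u] by uniqueness of limits. *)
Lemma expsum_cvg u :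
  geobound u -> mxcvg (series (fun k => k`!%:R^-1 *: u k)) (expsum u).
Proof.
move=> [c [K [c0 K0 uK]]].
have bnd (f : nat -> R) :
    (forall k, `|f k| <= mxabs (k`!%:R^-1 *: u k)) -> cvgn (series f).
  move=> fu; apply: normed_cvg.
  apply: nondecreasing_is_cvgn.
    by apply: nondecreasing_series => ? *; exact: normr_ge0.
  exists (c * expR K) => _ [m _ <-].
  rewrite (le_trans _ (mxabs_expsum_partial c0 K0 uK m)) //.
  by apply: ler_sum => k _; exact: fu.
have le_re z : `|complex.Re z| <= cabs z :> R by rewrite /cabs lerDl.
have le_im z : `|complex.Im z| <= cabs z :> R by rewrite /cabs lerDr.
pose S : M := \matrix_(i, j)
  (limn (series (fun k => complex.Re ((k`!%:R^-1 *: u k) i j)))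
   +i* limn (series (fun k => complex.Im ((k`!%:R^-1 *: u k) i j)))).
suff cS : mxcvg (series (fun k => k`!%:R^-1 *: u k)) S.
  by rewrite /expsum (mxcvg_lim cS).
move=> i j; split; rewrite mxE.
- rewrite (_ : (fun k => _) =
    series (fun k => complex.Re ((k`!%:R^-1 *: u k) i j))).
    by apply: bnd => k; exact: le_trans (le_re _) (cabs_le_mxabs _ _ _).
  by apply/funext => k; rewrite !seriesEnat /= summxE Re_sum.
- rewrite (_ : (fun k => _) =
    series (fun k => complex.Im ((k`!%:R^-1 *: u k) i j))).
    by apply: bnd => k; exact: le_trans (le_im _) (cabs_le_mxabs _ _ _).
  by apply/funext => k; rewrite !seriesEnat /= summxE Im_sum.
Qed.

Lemma mxabs_expsum u (c K : R) : 0 <= c -> 0 <= K ->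
  (forall k, mxabs (u k) <= c * K ^+ k) -> mxabs (expsum u) <= c * expR K.
Proof.
move=> c0 K0 uK; have gu : geobound u by exists c, K.
have cu := mxabs_cvg (expsum_cvg gu).
rewrite -(cvg_lim _ cu) //; apply: limr_le.
  by apply/cvg_ex; eexists; exact: cu.
apply: nearW => m; apply: le_trans (mxabs_expsum_partial c0 K0 uK m).
rewrite seriesEnat /=; elim/big_rec2: _ => [|k x y _ le_yx].
  by rewrite mxabs0.
by rewrite (le_trans (mxabsD _ _)) // lerD2l.
Qed.

Lemma expsumD u v : geobound u -> geobound v ->
  expsum (fun k => u k + v k) = expsum u + expsum v.
Proof.
move=> gu gv; apply: mxcvg_lim.
have := mxcvgD (expsum_cvg gu) (expsum_cvg gv).
congr (mxcvg _ _); apply/funext => m; rewrite !seriesEnat /= -big_split.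
by apply: eq_bigr => k _; rewrite scalerDr.
Qed.

Lemma expsumZ (r : R) u : geobound u ->
  expsum (fun k => r%:C *: u k) = r%:C *: expsum u.
Proof.
move=> gu; apply: mxcvg_lim.
have := mxcvgZr r (expsum_cvg gu).
congr (mxcvg _ _); apply/funext => m; rewrite !seriesEnat /= scaler_sumr.
by apply: eq_bigr => k _; rewrite !scalerA mulrC.
Qed.

Lemma expsum_single u m :
  (forall k, k != m -> u k = 0) -> expsum u = m`!%:R^-1 *: u m.
Proof.
move=> um; apply: mxcvg_lim => i j.
have eqN : \forall k \near \oo,
    series (fun k => k`!%:R^-1 *: u k) k = m`!%:R^-1 *: u m.
  near=> k; rewrite seriesEnat /= (bigD1_seq m) ?iota_uniq //=; last first.
    by rewrite mem_index_iota; near: k; exact: nbhs_infty_gt.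
  by rewrite big1 ?addr0 // => l lm; rewrite um // scaler0.
split; apply: cvg_near_cst; near=> k;
  rewrite (_ : series _ k = m`!%:R^-1 *: u m) //; near: k; exact: eqN.
Unshelve. all: by end_near. Qed.

End ExponentialSeries.

(** * Differentiation with quadratic error bounds, up to second order of the exponential *)

Section Differentials.
Variables (R : realType) (n : nat).
Local Notation C := R[i].
Local Notation M := 'M[C]_n.
Implicit Types (f g : R -> M) (A B D : M) (u v : nat -> M).

(* Differentiability at 0 with a quadratic error bound, which is stable under
   products and under summation of geometrically bounded series. *)
Definition diff0 f D : Prop := exists c : R, forall h, `|h| <= 1 ->
  mxabs (f h - f 0 - h%:C *: D) <= c * h ^+ 2.

Lemma diff0_cst A : diff0 (fun=> A) 0.
Proof.
by exists 0 => h _; rewrite subrr scaler0 subrr mxabs0 mul0r.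
Qed.

Lemma eq_diff0 f g D D' : f =1 g -> D = D' -> diff0 f D -> diff0 g D'.
Proof. by move=> /funext -> ->. Qed.

Lemma diff0D f g D D' :
  diff0 f D -> diff0 g D' -> diff0 (fun h => f h + g h) (D + D').
Proof.
move=> [c fD] [c' gD]; exists (c + c') => h h1.
rewrite (_ : _ - _ = (f h - f 0 - h%:C *: D) + (g h - g 0 - h%:C *: D')).
  by rewrite (le_trans (mxabsD _ _)) // mulrDl lerD ?fD ?gD.
by apply/matrixP => i j; rewrite !mxE; ring.
Qed.

(** For [|h| <= 1] a quadratic error is at most linear in [|h|]. The product rule uses this for its
    cross term. *)
Lemma diff0_lipschitz f D : diff0 f D ->
  exists2 c, 0 <= c & forall h, `|h| <= 1 -> mxabs (f h - f 0) <= c * `|h|.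
Proof.
move=> [c fD]; exists (`|c| + mxabs D); first by rewrite addr_ge0 ?mxabs_ge0.
move=> h h1; rewrite -(subrK (h%:C *: D) (f h - f 0)).
rewrite (le_trans (mxabsD _ _)) // mulrDl mxabsZr [_ * mxabs D]mulrC lerD2r.
rewrite (le_trans (fD h h1)) // -real_normK ?num_real // expr2 mulrA.
by rewrite ler_wpM2r // (le_trans (ler_wpM2r _ (ler_norm c))) // ler_piMr.
Qed.

Lemma diff0M f g D D' : diff0 f D -> diff0 g D' ->
  diff0 (fun h => f h *m g h) (D *m g 0 + f 0 *m D').
Proof.
move=> fD gD; have [a a0 fa] := diff0_lipschitz fD.
have [b b0 gb] := diff0_lipschitz gD; case: fD gD => [c fD] [c' gD].
exists (a * b + c * mxabs (g 0) + c' * mxabs (f 0)) => h h1.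
(* The product of increments is quadratic by the two Lipschitz bounds; the other summands are the
   errors of [f] and [g] times constant matrices. *)
rewrite (_ : _ - _ = (f h - f 0) *m (g h - g 0)
  + (f h - f 0 - h%:C *: D) *m g 0 + f 0 *m (g h - g 0 - h%:C *: D')).
  rewrite mulrDl [_ * h ^+ 2]mulrDl (le_trans (mxabsD _ _)) // lerD //.
    rewrite (le_trans (mxabsD _ _)) // lerD //.
      rewrite (le_trans (mxabsM _ _)) //.
      rewrite -real_normK ?num_real // expr2 mulrACA.
      by rewrite ler_pM ?mxabs_ge0 ?fa ?gb.
    rewrite (le_trans (mxabsM _ _)) // mulrAC ler_wpM2r ?mxabs_ge0 //.
    exact: fD.
  rewrite (le_trans (mxabsM _ _)) // mulrC mulrAC ler_wpM2r ?mxabs_ge0 //.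
  exact: gD.
rewrite !mulmxBl !mulmxBr scalerDr -scalemxAl -scalemxAr.
move: (f h *m g h) (f 0 *m g 0) (f h *m g 0) (f 0 *m g h) => x y z t.
move: (_ *: (D *m _)) (_ *: (_ *m D')) => p q.
by apply/matrixP => i j; rewrite !mxE; ring.
Qed.

(** Termwise differentiation: the termwise errors share a geometric bound proportional to [h ^+ 2],
    so the total error is at most [c * expR K * h ^+ 2]. *)
Lemma diff0_expsum (w : R -> nat -> M) v (c K : R) : 0 <= c -> 0 <= K ->
  (forall h k, `|h| <= 1 -> mxabs (w h k) <= c * K ^+ k) ->
  (forall k, mxabs (v k) <= c * K ^+ k) ->
  (forall h k, `|h| <= 1 ->
    mxabs (w h k - w 0 k - h%:C *: v k) <= h ^+ 2 * c * K ^+ k) ->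
  diff0 (fun h => expsum (w h)) (expsum v).
Proof.
move=> c0 K0 wK vK wv; exists (c * expR K) => h h1.
have gb u : (forall k, mxabs (u k) <= c * K ^+ k) -> geobound u.
  by move=> uK; exists c, K.
have gZ (r : R) u : geobound u -> geobound (fun k => r%:C *: u k).
  move=> [a [L [a0 L0 uL]]]; exists (`|r| * a), L.
  split => // [|k]; first exact: mulr_ge0.
  by rewrite mxabsZr -mulrA ler_wpM2l.
have gwh : geobound (w h) by apply: gb => k; exact: wK.
have gw0 : geobound (w 0) by apply: gb => k; apply: wK; rewrite normr0.
have gv := gb _ vK.
have scN1 A : - A = (-1 : R)%:C *: A by rewrite rmorphN1 scaleN1r.
have gN u : geobound u -> geobound (fun k => - u k).
  by rewrite (_ : (fun k => _) = fun k => (-1 : R)%:C *: u k);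
    [exact: gZ | apply/funext => k; exact: scN1].
have gD u u' : geobound u -> geobound u' -> geobound (fun k => u k + u' k).
  move=> [a [L [a0 L0 uL]]] [a' [L' [a'0 L'0 uL']]].
  exists (a + a'), (L + L'); split; rewrite ?addr_ge0 // => k.
  rewrite (le_trans (mxabsD _ _)) // mulrDl lerD //.
    rewrite (le_trans (uL k)) // ler_wpM2l //.
    by rewrite lerXn2r ?nnegrE ?addr_ge0 // lerDl.
  rewrite (le_trans (uL' k)) // ler_wpM2l //.
  by rewrite lerXn2r ?nnegrE ?addr_ge0 // lerDr.
have eN u : geobound u -> expsum (fun k => - u k) = - expsum u.
  move=> gu; rewrite (scN1 (expsum u)) -(expsumZ _ gu).
  by congr (expsum _); apply/funext => k; exact: scN1.
have gh := gZ h _ gv.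
(* The total error becomes a single [expsum] of termwise errors, to which [mxabs_expsum] applies. *)
rewrite -expsumZ // -(eN _ gh) -(eN _ gw0) -(expsumD gwh (gN _ gw0)).
rewrite -(expsumD (gD _ _ gwh (gN _ gw0)) (gN _ gh)).
rewrite (le_trans (@mxabs_expsum _ _ _ (h ^+ 2 * c) K _ K0 _)) //.
- by rewrite mulr_ge0 ?sqr_ge0.
- by move=> k; exact: wv.
- by rewrite -mulrA mulrC.
Qed.

(** Since the terms below [m] vanish, this is a power series in [s], and its derivative at 0 is the
    coefficient of the first power, at [k = m.+1]. Truncated subtraction is harmless because it only
    affects vanishing terms. The case [m = 0] serves exponentials, [m = 1] serves [dexpmx]. *)
Lemma diff0_expsum_power m u : geobound u -> (forall k, (k < m)%N -> u k = 0) ->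
  diff0 (fun s => expsum (fun k => (s ^+ (k - m))%:C *: u k))
        (m.+1`!%:R^-1 *: u m.+1).
Proof.
move=> [c [K [c0 K0 uK]]] um.
pose v k := if k == m.+1 then u k else 0.
have -> : m.+1`!%:R^-1 *: u m.+1 = expsum v.
  rewrite (@expsum_single _ _ _ m.+1) /v ?eqxx // => k.
  by rewrite eq_sym => /negbTE; rewrite eq_sym => ->.
apply: (diff0_expsum c0 K0) => [h k h1|k|h k h1].
- rewrite mxabsZr (le_trans _ (uK k)) // ler_piMl ?mxabs_ge0 //.
  by rewrite normrX exprn_ile1.
- by rewrite /v; case: ifP => // _; rewrite mxabs0 mulr_ge0 ?exprn_ge0.
have bnd0 : 0 <= h ^+ 2 * c * K ^+ k.
  by rewrite mulr_ge0 ?exprn_ge0 // mulr_ge0 ?sqr_ge0.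
rewrite /v; have [km|km|kE] := ltngtP k m.
- by rewrite um // (ltn_eqF (ltn_trans km (ltnSn m))) !scaler0 !subr0 mxabs0.
- have [kE|km1] := eqVneq k m.+1.
    by rewrite kE subSnn !expr1 scale0r subr0 subrr mxabs0 -kE.
  (* Past [m.+1] the exponent is at least 2, so the power of [|h|] is below [h ^+ 2]; all other
     terms have zero error. *)
  have m2 : (2 <= k - m)%N by rewrite ltn_subRL addn1 ltn_neqAle eq_sym km1.
  rewrite scaler0 subr0 expr0n subn_eq0 leqNgt km scale0r subr0 mxabsZr.
  rewrite -mulrA ler_pM ?mxabs_ge0 // normrX -[leRHS]real_normK ?num_real //.
  by rewrite ler_wiXn2l.
- by rewrite kE subnn !expr0 subrr (ltn_eqF (ltnSn m)) scaler0 subr0 mxabs0 -kE.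
Qed.

(** The convention [0 ^+ 0 = 1] keeps the term [k = m]; later terms carry a positive power of 0. *)
Lemma expsum_power0 m u : (forall k, (k < m)%N -> u k = 0) ->
  expsum (fun k => ((0 : R) ^+ (k - m))%:C *: u k) = m`!%:R^-1 *: u m.
Proof.
move=> um; rewrite (@expsum_single _ _ _ m) ?subnn ?expr0 ?scale1r // => k.
case: ltngtP => // km _; first by rewrite um ?scaler0.
by rewrite expr0n subn_eq0 leqNgt km scale0r.
Qed.

Lemma exprZmx (c : C) A k : (c *: A) ^+ k = c ^+ k *: A ^+ k.
Proof.
elim: k => [|k IH]; first by rewrite !expr0 scale1r.
by rewrite !exprS IH -mulmxE -scalemxAl -scalemxAr scalerA.
Qed.

Lemma expmxE A : expmx A = expsum (fun k => A ^+ k).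
Proof. by []. Qed.

Lemma mxabsX A k : mxabs (A ^+ k) <= mxabs (1 : M) * mxabs A ^+ k.
Proof.
elim: k => [|k IH]; first by rewrite !expr0 mulr1.
rewrite exprS (le_trans (mxabsM _ _)) // exprS mulrCA.
by rewrite ler_wpM2l ?mxabs_ge0.
Qed.

Lemma diff0_expmxZ A : diff0 (fun s => expmx (s%:C *: A)) A.
Proof.
have gA : geobound (fun k => A ^+ k).
  exists (mxabs (1 : M)), (mxabs A).
  by rewrite !mxabs_ge0; split => // k; exact: mxabsX.
have A0 k : (k < 0)%N -> A ^+ k = 0 by [].
apply: eq_diff0 (diff0_expsum_power gA A0).
  move=> s; rewrite expmxE; congr (expsum _); apply/funext => k.
  by rewrite subn0 exprZmx rmorphXn.
by rewrite invr1 scale1r expr1.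
Qed.

Lemma expmx0 : expmx (0 : M) = 1%:M.
Proof.
rewrite expmxE (@expsum_single _ _ _ 0) ?invr1 ?scale1r ?expr0 // => k.
by move=> /negbTE k0; rewrite expr0n k0.
Qed.

(* Noncommutative Leibniz rule: the derivative of A ^+ k in the direction B. *)
Fixpoint dexpr A B k : M :=
  if k is k'.+1 then A * dexpr A B k' + B * A ^+ k' else 0.

(** Each step of the recursion adds two products, each costing a factor [K]; hence [2 * K]. *)
Lemma mxabs_dexpr A B (K : R) k : mxabs A <= K -> mxabs B <= K ->
  mxabs (dexpr A B k) <= mxabs (1 : M) * (2 * K) ^+ k.
Proof.
move=> AK BK; have K0 := le_trans (mxabs_ge0 A) AK.
elim: k => [|k IH] /=; first by rewrite mxabs0 expr0 mulr1 mxabs_ge0.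
have AX : mxabs (A ^+ k) <= mxabs (1 : M) * (2 * K) ^+ k.
  rewrite (le_trans (mxabsX _ _)) // ler_wpM2l ?mxabs_ge0 //.
  by rewrite lerXn2r ?nnegrE ?mxabs_ge0 ?mulr_ge0 // (le_trans AK) // ler_peMl ?ler1n.
have leA := le_trans (mxabsM _ _) (ler_pM (mxabs_ge0 _) (mxabs_ge0 _) AK IH).
have leB := le_trans (mxabsM _ _) (ler_pM (mxabs_ge0 _) (mxabs_ge0 _) BK AX).
apply: le_trans (mxabsD _ _) (le_trans (lerD leA leB) _).
by rewrite le_eqVlt; apply/orP; left; apply/eqP; rewrite exprS; ring.
Qed.

(** By induction: the error at [k.+1] is [A + h%:C *: B] times the error at [k], plus [h ^+ 2] times
    [B * dexpr A B k]. The left factors are bounded by [2 * K] and [K], which add up to [3 * K]. *)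
Lemma expr_taylor A B (K h : R) k : mxabs A <= K -> mxabs B <= K -> `|h| <= 1 ->
  mxabs ((A + h%:C *: B) ^+ k - A ^+ k - h%:C *: dexpr A B k)
  <= h ^+ 2 * mxabs (1 : M) * (3 * K) ^+ k.
Proof.
move=> AK BK h1; have K0 := le_trans (mxabs_ge0 A) AK.
elim: k => [|k IH].
  by rewrite !expr0 subrr scaler0 subr0 mxabs0 mulr1 mulr_ge0 ?sqr_ge0 ?mxabs_ge0.
set e := (X in mxabs X) in IH.
rewrite (_ : _ - _ - _ = (h ^+ 2)%:C *: (B * dexpr A B k)
  + (A + h%:C *: B) * e); last first.
  rewrite [in RHS]expr2 (rmorphM (real_complex R)) -scalerA.
  rewrite [dexpr A B k.+1]/(_ + _) /e !exprS !mulrBr.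
  rewrite (mulrDl A _ (A ^+ k)) (mulrDl A _ (h%:C *: _)).
  rewrite -!mulmxE -!scalemxAr -!scalemxAl !mulmxE scalerDr.
  move: ((A + _) * _) (A * A ^+ k) => x y.
  move: (h%:C *: (A * _)) (h%:C *: (B * A ^+ k)) => z t.
  move: (_ *: (_ *: (B * _))) => w.
  by apply/matrixP => i j; rewrite !mxE; ring.
rewrite (le_trans (mxabsD _ _)) // mxabsZr.
have KAB : mxabs (A + h%:C *: B) <= 2 * K.
  rewrite (le_trans (mxabsD _ _)) // mxabsZr mulr2n mulrDl mul1r lerD //.
  by rewrite (le_trans _ BK) // ler_piMl ?mxabs_ge0.
have bD : mxabs (dexpr A B k) <= mxabs (1 : M) * (3 * K) ^+ k.
  rewrite (le_trans (mxabs_dexpr k AK BK)) // ler_wpM2l ?mxabs_ge0 //.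
  by rewrite lerXn2r ?nnegrE ?mulr_ge0 // ler_wpM2r // ler_nat.
have := le_trans (mxabsM _ _) (ler_pM (mxabs_ge0 _) (mxabs_ge0 _) BK bD).
have := le_trans (mxabsM _ _) (ler_pM (mxabs_ge0 _) (mxabs_ge0 _) KAB IH).
rewrite ger0_norm ?sqr_ge0 // -!mulmxE => H1 /(ler_wpM2l (sqr_ge0 h)) H2.
rewrite addrC; apply: le_trans (lerD H1 H2) _.
by rewrite le_eqVlt; apply/orP; left; apply/eqP; rewrite [_ ^+ k.+1]exprS; ring.
Qed.

(** The derivative of the exponential at [A] in the direction [B], as the termwise differentiated
    series. *)
Definition dexpmx A B : M := expsum (dexpr A B).

Lemma diff0_expmx A B : diff0 (fun h => expmx (A + h%:C *: B)) (dexpmx A B).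
Proof.
pose K := mxabs A + mxabs B.
have AK : mxabs A <= K by rewrite lerDl mxabs_ge0.
have BK : mxabs B <= K by rewrite lerDr mxabs_ge0.
have K0 := le_trans (mxabs_ge0 A) AK.
apply: (@diff0_expsum _ _ (mxabs (1 : M)) (3 * K)).
- exact: mxabs_ge0.
- by rewrite mulr_ge0.
- move=> h k h1; rewrite (le_trans (mxabsX _ _)) // ler_wpM2l ?mxabs_ge0 //.
  rewrite lerXn2r ?nnegrE ?mxabs_ge0 ?mulr_ge0 // (le_trans (mxabsD _ _)) //.
  rewrite mxabsZr (@le_trans _ _ K) // ?ler_peMl ?ler1n // lerD2l.
  by rewrite ler_piMl ?mxabs_ge0.
- move=> k; rewrite (le_trans (mxabs_dexpr k AK BK)) // ler_wpM2l ?mxabs_ge0 //.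
  by rewrite lerXn2r ?nnegrE ?mulr_ge0 // ler_wpM2r // ler_nat.
- move=> h k h1; have -> : A + 0%:C *: B = A by rewrite scale0r addr0.
  exact: expr_taylor k AK BK h1.
Qed.

(** [dexpr A B k] is homogeneous of degree [k - 1] in [A]; at [k = 0] both sides are 0. *)
Lemma dexprZ (s : R) A B k :
  dexpr (s%:C *: A) B k = (s ^+ (k - 1))%:C *: dexpr A B k.
Proof.
elim: k => [|[|k] IH]; first by rewrite scaler0.
  by rewrite /= !mulr0 !expr0 scale1r.
have dS A' j : dexpr A' B j.+1 = A' *m dexpr A' B j + B *m A' ^+ j by [].
rewrite dS IH exprZmx -!scalemxAl -!scalemxAr scalerA [dexpr A B k.+2]dS.
rewrite scalerDr !subn1 /= -(rmorphM (real_complex R)) -exprS.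
by congr (_ + _ *: _); rewrite rmorphXn.
Qed.

(** The mixed second derivative of the exponential at 0: [diff0_expsum_power] with [m = 1] gives
    [dexpr A B 2] over [2!], and [dexpr A B 2] is the anticommutator. *)
Lemma diff0_dexpmxZ A B :
  diff0 (fun s => dexpmx (s%:C *: A) B) (2^-1 *: (A *m B + B *m A)).
Proof.
have gD : geobound (dexpr A B).
  exists (mxabs (1 : M)), (2 * (mxabs A + mxabs B)).
  split; rewrite ?mulr_ge0 ?addr_ge0 ?mxabs_ge0 // => k.
  by apply: mxabs_dexpr; rewrite ?lerDl ?lerDr mxabs_ge0.
have D0 k : (k < 1)%N -> dexpr A B k = 0 by case: k.
apply: eq_diff0 (diff0_expsum_power gD D0).
  by move=> s; congr (expsum _); apply/funext => k; rewrite dexprZ.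
by rewrite /= !expr0 expr1 mulr0 add0r mulr1 -!mulmxE.
Qed.

Lemma dexpmx0 B : dexpmx 0 B = B.
Proof.
have D0 k : (k < 1)%N -> dexpr 0 B k = 0 by case: k.
transitivity (expsum (fun k => ((0 : R) ^+ (k - 1))%:C *: dexpr 0 B k)).
  by congr (expsum _); apply/funext => k; rewrite -dexprZ scaler0.
by rewrite (expsum_power0 D0) /= invr1 scale1r mulr0 add0r expr0 mulr1.
Qed.

End Differentials.

(** After division by [|h|] the error is at most [c * |h|]. This passes from error bounds to the
    derivative ['D_v]. *)
Lemma derive_quadratic (R : realType) (V : normedModType R) (f : V -> R)
    (a v : V) (D c : R) :
  (forall h : R, `|h| <= 1 -> `|f (h *: v + a) - f a - h * D| <= c * h ^+ 2) ->
  'D_v f a = D.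
Proof.
move=> fD; apply: cvg_lim => //; apply/cvgrPdist_lt => e e0.
(* Adding 1 keeps the threshold on [h] meaningful when [c] is 0. *)
have c1 : 0 < `|c| + 1 by rewrite ltr_wpDl.
near=> h.
have h0 : h != 0 by near: h; exact: nbhs_dnbhs_neq.
have h1 : `|h| <= 1 by near: h; exact: dnbhs0_le.
have he : `|h| < e / (`|c| + 1).
  by near: h; apply: dnbhs0_lt; rewrite divr_gt0.
rewrite /= -(ltr_pM2l (_ : 0 < `|h|)) ?normr_gt0 // -normrM mulrBr.
rewrite [_ *: _]/(_ * _) mulrA mulfV // mul1r distrC.
rewrite (le_lt_trans (fD h h1)) // -real_normK ?num_real // expr2 mulrA.
rewrite mulrC ltr_pM2l ?normr_gt0 //.
rewrite (@le_lt_trans _ _ ((`|c| + 1) * `|h|)) //.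
  by rewrite ler_wpM2r // (le_trans (ler_norm c)) // lerDl.
by rewrite mulrC -ltr_pdivlMr.
Unshelve. all: by end_near. Qed.

(** * The Hessian of the energy *)

Section BilinearExpansions.
Variables (F : comNzRingType) (n : nat).
Implicit Types (A B P Q rho H : 'M[F]_n).

(** For [c = 1/2] this is the mixed second derivative at 0 of the conjugation of [rho] by the
    exponentials; for hermitian [P = Q] it is twice the dissipator of [P]. The scalar [c] is a
    parameter because 2 need not be invertible in [F]. *)
Definition hess_mx (c : F) P Q rho : 'M[F]_n :=
  P *m rho *m Q + Q *m rho *m P
  - c *: ((P *m Q + Q *m P) *m rho + rho *m (P *m Q + Q *m P)).

Lemma hess_mx_linearl c r P P' Q rho :
  hess_mx c (r *: P + P') Q rho = r *: hess_mx c P Q rho + hess_mx c P' Q rho.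
Proof.
rewrite /hess_mx !(mulmxDl, mulmxDr) -!scalemxAl -!scalemxAr -!scalemxAl.
by apply/matrixP => i j; do ![rewrite [in LHS]mxE | rewrite [in RHS]mxE]; ring.
Qed.

(** The next four expansions are stated under the trace, so that [trace_coupling] ends in a scalar
    identity closed by [ring]. *)
Lemma trace_sandwichD A B A' B' rho H :
  \tr ((A + B) *m rho *m (A' + B') *m H)
  = \tr (A *m rho *m A' *m H) + \tr (A *m rho *m B' *m H)
    + \tr (B *m rho *m A' *m H) + \tr (B *m rho *m B' *m H).
Proof. by rewrite !(mulmxDl, mulmxDr, mxtraceD) addrACA addrA. Qed.

Lemma trace_sandwichZ c d A A' rho H :
  \tr ((c *: A) *m rho *m (d *: A') *m H) = c * d * \tr (A *m rho *m A' *m H).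
Proof.
by rewrite -!scalemxAl -scalemxAr -scalemxAl scalerA mxtraceZ.
Qed.

Lemma trace_mulD A B A' B' H :
  \tr ((A + B) *m (A' + B') *m H)
  = \tr (A *m A' *m H) + \tr (A *m B' *m H)
    + \tr (B *m A' *m H) + \tr (B *m B' *m H).
Proof. by rewrite !(mulmxDl, mulmxDr, mxtraceD) !addrA. Qed.

Lemma trace_mulZ c d A A' H :
  \tr ((c *: A) *m (d *: A') *m H) = c * d * \tr (A *m A' *m H).
Proof.
by rewrite -scalemxAl -scalemxAr -!scalemxAl scalerA mxtraceZ.
Qed.

Lemma trace_hess_mx c P rho H :
  \tr (hess_mx c P P rho *m H) =
  2 * \tr (P *m rho *m P *m H)
  - c * 2 * (\tr (P *m P *m (rho *m H)) + \tr (P *m P *m (H *m rho))).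
Proof.
have cyc : \tr (rho *m (P *m P) *m H) = \tr (P *m P *m (H *m rho)).
  by rewrite -(mulmxA rho) mxtrace_mulC !mulmxA.
rewrite /hess_mx mulmxBl -scalemxAl raddfB /= mxtraceZ.
rewrite !(mulmxDl, mulmxDr, mxtraceD) cyc [P *m P *m (rho *m H)]mulmxA; ring.
Qed.

End BilinearExpansions.

Lemma trace_tens (F : comNzRingType) m n (A : 'M[F]_m) (B : 'M[F]_n) :
  \tr (A *t B) = \tr A * \tr B.
Proof.
rewrite /mxtrace mulr_sum; apply: eq_bigr => k _.
by case: (mxtens_indexP k) => i j; rewrite tensmxE mxtens_indexK.
Qed.

(** The ancilla enters only through four values of [f]. In the sandwich term cyclicity reverses the
    ancilla factors, so the coefficients 1, [-i], [i], 1 assemble [L *m rho *m L']; in the square of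
    [G] the order is kept and the same values assemble [L' *m L]. *)
Lemma trace_coupling (F : comNzRingType) a n (X Y E : 'M[F]_a) (f : 'M[F]_a -> F) (i c : F)
    (L1 L2 rho H : 'M[F]_n) (G := X *t L1 + Y *t L2)
    (L := L1 + i *: L2) (L' := L1 - i *: L2) :
  i * i = -1 -> (forall A : 'M[F]_a, \tr (E *m A) = f A) ->
  [/\ f (X *m X) = 1, f (X *m Y) = i, f (Y *m X) = - i & f (Y *m Y) = 1] ->
  \tr (hess_mx c G G (E *t rho) *m (1%:M *t H))
  = 2 * \tr ((L *m rho *m L' - c *: (L' *m L *m rho + rho *m (L' *m L))) *m H).
Proof.
move=> ii trE [XX XY YX YY].
have tr_sandwich (A B : 'M[F]_a) (U V : 'M[F]_n) :
    \tr (A *t U *m (E *t rho) *m (B *t V) *m (1%:M *t H))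
    = f (B *m A) * \tr (U *m rho *m V *m H).
  rewrite !tensmx_mul trace_tens mulmx1 -(mulmxA A) mxtrace_mulC.
  by rewrite -(mulmxA E) trE.
have tr_square (A B : 'M[F]_a) (U V W : 'M[F]_n) :
    \tr (A *t U *m (B *t V) *m (E *t W)) = f (A *m B) * \tr (U *m V *m W).
  by rewrite !tensmx_mul trace_tens [\tr (A *m B *m _)]mxtrace_mulC trE.
rewrite trace_hess_mx tensmx_mul (tensmx_mul 1%:M) mulmx1 mul1mx.
rewrite trace_sandwichD !trace_mulD !tr_sandwich !tr_square XX XY YX YY.
have L'E : L' = 1 *: L1 + (- i) *: L2 by rewrite scale1r scaleNr.
have LE : L = 1 *: L1 + i *: L2 by rewrite scale1r.
have cyc (W : 'M[F]_n) : \tr (rho *m W *m H) = \tr (W *m (H *m rho)).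
  by rewrite -mulmxA mxtrace_mulC mulmxA.
clearbody L L'.
rewrite mulmxBl -scalemxAl raddfB /= mxtraceZ mulmxDl mxtraceD cyc.
rewrite -[L' *m L *m rho *m H]mulmxA L'E LE; clear L'E LE.
rewrite trace_sandwichD !trace_mulD !trace_sandwichZ !trace_mulZ.
rewrite !(mul1r, mulr1, mulrN, mulNr, ii, opprK); ring.
Qed.

(** * Second derivatives of the energy and first derivative of the dissipative evolution *)

Section Hessian.
Variables (R : realType) (n : nat).
Local Notation C := R[i].
Local Notation M := 'M[C]_n.
Implicit Types (f g : R -> M) (A B D P rho H : M).

Lemma diff0Mr f D A : diff0 f D -> diff0 (fun h => f h *m A) (D *m A).
Proof.
move=> fD; apply: (eq_diff0 (frefl _) _ (diff0M fD (diff0_cst A))).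
by rewrite mulmx0 addr0.
Qed.

Lemma Re_trace_linear A B D (h : R) :
  complex.Re (\tr (A - B - h%:C *: D))
  = complex.Re (\tr A) - complex.Re (\tr B) - h * complex.Re (\tr D).
Proof.
rewrite !raddfB /= mxtraceZ.
by case: (\tr A) (\tr B) (\tr D) => [? ?] [? ?] [? ?] /=; rewrite mul0r subr0.
Qed.

Lemma derive_Re_trace (V : normedModType R) (E : V -> R) (a v : V) f D :
  (forall h : R, E (h *: v + a) = complex.Re (\tr (f h))) -> diff0 f D ->
  'D_v E a = complex.Re (\tr D).
Proof.
move=> Ef [c fD]; apply: (@derive_quadratic _ _ _ _ _ _ c) => h h1.
have -> : E a = complex.Re (\tr (f 0)) by rewrite -Ef scale0r add0r.
by rewrite Ef -Re_trace_linear (le_trans (Re_trace_le _)) ?fD.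
Qed.

Lemma diff0_conj_expmx A B A' B' rho H :
  diff0 (fun h => expmx (A + h%:C *: B) *m rho *m expmx (A' + h%:C *: B') *m H)
    ((dexpmx A B *m rho *m expmx A' + expmx A *m rho *m dexpmx A' B') *m H).
Proof.
apply: diff0Mr; apply: (eq_diff0 (frefl _) _
  (diff0M (diff0Mr rho (diff0_expmx A B)) (diff0_expmx A' B'))).
by rewrite !scale0r !addr0.
Qed.

(** The half anticommutators come from differentiating one exponential twice, with equal signs since
    [(- A) *m (- B)] is [A *m B]; the negative terms come from differentiating each exponential
    once. *)
Lemma diff0_dconj_expmx A B rho H :
  diff0 (fun s => (dexpmx (s%:C *: A) B *m rho *m expmx (s%:C *: (- A))
      + expmx (s%:C *: A) *m rho *m dexpmx (s%:C *: (- A)) (- B)) *m H)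
    ((2^-1 *: ((A *m B + B *m A) *m rho + rho *m (A *m B + B *m A))
      - B *m rho *m A - A *m rho *m B) *m H).
Proof.
apply: diff0Mr; apply: (eq_diff0 (frefl _) _ (diff0D
  (diff0M (diff0Mr rho (diff0_dexpmxZ A B)) (diff0_expmxZ (- A)))
  (diff0M (diff0Mr rho (diff0_expmxZ A)) (diff0_dexpmxZ (- A) (- B))))).
rewrite !scale0r !dexpmx0 expmx0 mulmx1 mul1mx !mulmxN !mulNmx !opprK.
rewrite -scalemxAl -scalemxAr [in RHS]scalerDr.
move: (_ *: _) (B *m rho *m A) (A *m rho *m B) (_ *: _) => x y z t.
by apply/matrixP => i j; rewrite !mxE; ring.
Qed.

Definition hess_form P Q rho H : R :=
  complex.Re (\tr (hess_mx 2^-1 P Q rho *m H)).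

Lemma dconj_expmx_hess_mx P Q rho (A := - 'i *: P) (B := - 'i *: Q) :
  2^-1 *: ((A *m B + B *m A) *m rho + rho *m (A *m B + B *m A))
    - B *m rho *m A - A *m rho *m B
  = hess_mx 2^-1 P Q rho.
Proof.
rewrite /hess_mx.
have iMi X Y : (- 'i *: X) *m (- 'i *: Y) = - (X *m Y) :> M.
  by rewrite -scalemxAl -scalemxAr scalerA mulrNN -expr2 sqrCi scaleN1r.
have iMMi X Y Z : (- 'i *: X) *m Y *m (- 'i *: Z) = - (X *m Y *m Z) :> M.
  by rewrite -scalemxAl iMi.
rewrite /A /B !iMi !iMMi !mulmxDl !mulmxDr !mulNmx !mulmxN.
move: (P *m Q *m rho) (Q *m P *m rho) (rho *m _) (rho *m _) => x y z t.
move: (Q *m rho *m P) (P *m rho *m Q) => p q.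
by apply/matrixP => i l; rewrite !mxE; ring.
Qed.

Lemma hessian_energy d (P : 'I_d -> M) rho H j k :
  hessian (energy P rho H) 0 j k = hess_form (P j) (P k) rho H.
Proof.
pose A : M := - 'i *: P j; pose B : M := - 'i *: P k.
(* The inner derivative is computed at every point of the line spanned by ['e_j], so that it can be
   differentiated again in [s]. *)
have dE (s : R) : 'D_('e_k) (energy P rho H) (s *: 'e_j + 0) =
  complex.Re (\tr ((dexpmx (s%:C *: A) B *m rho *m expmx (s%:C *: (- A))
      + expmx (s%:C *: A) *m rho *m dexpmx (s%:C *: (- A)) (- B)) *m H)).
  apply: derive_Re_trace (diff0_conj_expmx _ _ _ _ _ _) => h.
  rewrite /energy; set G := \sum_(l < d) _.
  (* The two coordinate contributions are summed separately, so [j = k] needs no special case. *)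
  have -> : G = s%:C *: P j + h%:C *: P k.
    rewrite /G addr0; under eq_bigr do
      rewrite !mxE eqxx /= rmorphD !rmorphM !rmorph_nat scalerDl.
    rewrite big_split /= addrC; congr (_ + _).
      rewrite (bigD1 j) //= eqxx mulr1 big1 ?addr0 // => l /negbTE lj.
      by rewrite lj mulr0 scale0r.
    rewrite (bigD1 k) //= eqxx mulr1 big1 ?addr0 // => l /negbTE lk.
    by rewrite lk mulr0 scale0r.
  have -> : - 'i *: (s%:C *: P j + h%:C *: P k) = s%:C *: A + h%:C *: B.
    by rewrite scalerDr !scalerA ![- 'i * _]mulrC.
  have -> : 'i *: (s%:C *: P j + h%:C *: P k) =
      s%:C *: - A + h%:C *: - B.
    have -> : - A = 'i *: P j by rewrite /A scaleNr opprK.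
    have -> : - B = 'i *: P k by rewrite /B scaleNr opprK.
    by rewrite scalerDr !scalerA ['i * s%:C]mulrC ['i * h%:C]mulrC.
  by [].
rewrite mxE (derive_Re_trace dE (diff0_dconj_expmx _ _ _ _)) /hess_form.
by rewrite dconj_expmx_hess_mx.
Qed.

(** The bound on [T] makes its iterates grow geometrically, and homogeneity pulls [t ^+ k] out of
    the [k]-th one; the coefficient of the first power is then [T rho]. *)
Lemma derive1_expsuper (T : M -> M) (K : R) rho H : 0 <= K ->
  (forall c A, T (c *: A) = c *: T A) ->
  (forall A, mxabs (T A) <= K * mxabs A) ->
  derive1 (fun t : R => complex.Re (\tr
    (expsuper (fun sigma => t%:C *: T sigma) rho *m H))) 0
  = complex.Re (\tr (T rho *m H)).
Proof.
move=> K0 TZ TK; rewrite derive1E.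
have gT : geobound (fun k => iter k T rho).
  exists (mxabs rho), K; split; rewrite ?mxabs_ge0 // => k.
  elim: k => [|k IH] /=; first by rewrite expr0 mulr1.
  by rewrite (le_trans (TK _)) // exprS mulrCA ler_wpM2l.
have T0 k : (k < 0)%N -> iter k T rho = 0 by [].
have iterE (t : R) k :
    iter k (fun sigma => t%:C *: T sigma) rho = (t ^+ (k - 0))%:C *: iter k T rho.
  rewrite subn0; elim: k => [|k IH]; first by rewrite expr0 scale1r.
  by rewrite !iterS IH TZ scalerA -(rmorphM (real_complex R)) -exprS.
have dT : diff0 (fun t => expsuper (fun sigma => t%:C *: T sigma) rho) (T rho).
  apply: eq_diff0 (diff0_expsum_power gT T0).
    by move=> t; congr (expsum _); apply/funext => k; rewrite iterE.
  by rewrite invr1 scale1r.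
apply: derive_Re_trace (diff0Mr H dT) => h.
by rewrite addr0 [h *: 1]mulr1.
Qed.

End Hessian.

(** * Pauli operators *)

Section TensorAlgebra.
Variable R : realType.
Local Notation C := R[i].

Lemma tensmxDr m n p q (A : 'M[C]_(m, n)) (B B' : 'M[C]_(p, q)) :
  A *t (B + B') = A *t B + A *t B'.
Proof.
apply/matrixP => i j; case: (mxtens_indexP i) => i0 i1.
by case: (mxtens_indexP j) => j0 j1; rewrite !mxE mulrDr.
Qed.

Lemma tensmxZr m n p q c (A : 'M[C]_(m, n)) (B : 'M[C]_(p, q)) :
  A *t (c *: B) = c *: (A *t B).
Proof.
apply/matrixP => i j; case: (mxtens_indexP i) => i0 i1.
by case: (mxtens_indexP j) => j0 j1; rewrite !mxE mulrCA.
Qed.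

Lemma tensmx_sumr (I : Type) (r : seq I) m n p q
    (A : 'M[C]_(m, n)) (B : I -> 'M[C]_(p, q)) :
  A *t (\sum_(i <- r) B i) = \sum_(i <- r) A *t B i.
Proof.
elim/big_rec2: _ => [|i y z _ <-]; first exact: tensmx0.
by rewrite tensmxDr.
Qed.

(** Arbitrary factors are allowed because a product of Pauli matrices need not be one of the
    four. *)
Definition tensor_op n (M : 'I_n -> 'M[C]_2) : 'M[C]_(qdim n) :=
  \matrix_(x, y) \prod_(q < n) M q (bits x q) (bits y q).

(** The sum over intermediate bit strings of a product over qubits is, by distributivity, the
    product of the one-qubit sums. *)
Lemma tensor_opM n (M M' : 'I_n -> 'M[C]_2) :
  tensor_op M *m tensor_op M' = tensor_op (fun q => M q *m M' q).
Proof.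
apply/matrixP => x y; rewrite !mxE.
under [RHS]eq_bigr do rewrite mxE.
rewrite bigA_distr_bigA /= (reindex (@bits n)) /=; last first.
  by exists (@bindex n) => z _; rewrite /bits /bindex ?enum_valK ?enum_rankK.
by apply: eq_bigr => z _; rewrite !mxE -big_split.
Qed.

Lemma adjoint_pauli_op n (s : 'I_n -> pauli) :
  map_mx Num.conj (pauli_op R s)^T = pauli_op R s.
Proof.
apply/matrixP => x y; rewrite !mxE rmorph_prod; apply: eq_bigr => q _.
have I0 : 'i%C = 'i%R :> C by exact: complexiE.
case: (s q) => /=; rewrite !mxE; case: (bits x q) => [[|[|//]] ?];
  case: (bits y q) => [[|[|//]] ?] //=;
  by rewrite ?rmorph0 ?rmorph1 ?rmorphN1 ?rmorphN ?I0 /= ?conjCi ?opprK.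
Qed.

Lemma tr_proj0 n (A : 'M[C]_(qdim n)) :
  \tr (proj0 R n *m A) = A (bindex [ffun=> ord0]) (bindex [ffun=> ord0]).
Proof.
rewrite /proj0; set z := bindex _; rewrite /mxtrace (bigD1 z) //= big1 ?addr0.
  rewrite mxE (bigD1 z) //= big1 ?addr0 ?mxE ?eqxx ?mul1r // => i /negbTE iz.
  by rewrite !mxE iz andbF mul0r.
move=> i /negbTE iz; rewrite mxE big1 // => j _.
by rewrite mxE iz mul0r.
Qed.

(** Every qubit other than [q] contributes the upper left entry of the identity, which is 1. *)
Lemma pauli_at_mul00 n p p' (q : 'I_n) (z := bindex [ffun=> ord0]) :
  (pauli_at R p q *m pauli_at R p' q) z z
  = (pauli_mx R p *m pauli_mx R p') ord0 ord0.
Proof.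
rewrite [pauli_at _ _ _ *m _]tensor_opM mxE (bigD1 q) //= big1 => [|j /negbTE jq].
  by rewrite eqxx mulr1 /bits /z /bindex enum_rankK !ffunE.
rewrite jq /bits /z /bindex enum_rankK !ffunE mxE !big_ord_recl big_ord0.
by rewrite !mxE /= mul1r mul0r !addr0.
Qed.

(** X and Y square to I, while XY = iZ and YX = -iZ, and the upper left entry of Z is 1. *)
Lemma pauli_XY00 :
  [/\ (pauli_mx R PauliX *m pauli_mx R PauliX) ord0 ord0 = 1,
      (pauli_mx R PauliX *m pauli_mx R PauliY) ord0 ord0 = 'i%R,
      (pauli_mx R PauliY *m pauli_mx R PauliX) ord0 ord0 = - 'i%R
    & (pauli_mx R PauliY *m pauli_mx R PauliY) ord0 ord0 = 1].
Proof.
have I0 : 'i%C = 'i%R :> C by exact: complexiE.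
split; rewrite mxE !big_ord_recl big_ord0 !mxE /=
  ?I0 ?mul0r ?mulr0 ?mul1r ?mulr1 ?addr0 ?add0r //.
by rewrite mulNr -expr2 sqrCi opprK.
Qed.

Definition pauli_of (p : 'I_4) : pauli :=
  nth PauliI [:: PauliI; PauliX; PauliY; PauliZ] p.

(** Completeness of the Pauli matrices as an orthogonal basis, checked on all sixteen choices of
    indices. *)
Lemma pauli_completeness (a b u v : 'I_2) :
  \sum_p 2^-1 * pauli_mx R (pauli_of p) b a * pauli_mx R (pauli_of p) u v
  = ((a == u) && (b == v))%:R.
Proof.
have I0 : 'i%C = 'i%R :> C by exact: complexiE.
have i2 : 'i%R * 'i%R = -1 :> C by rewrite -expr2 sqrCi.
have h2 : 2^-1 + 2^-1 = 1 :> C by have := splitr (1 : C); rewrite !mul1r => <-.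
rewrite !big_ord_recl big_ord0 /pauli_of /=.
case: a => [[|[|//]] ?]; case: b => [[|[|//]] ?];
  case: u => [[|[|//]] ?]; case: v => [[|[|//]] ?] //=; rewrite !mxE /=
  ?I0 ?mul0r ?mulr0 ?mul1r ?mulr1 ?addr0 ?add0r ?mulrN ?mulNr ?opprK
  -?mulrA ?i2 ?mulrN ?mulr1 ?opprK ?addrN ?addNr ?h2 ?mul0r ?oppr0 //.
Qed.

Lemma pauli_decomposition n (L : 'M[C]_(qdim n)) :
  exists c : {ffun 'I_n -> 'I_4} -> C,
    L = \sum_s c s *: pauli_op R (fun q => pauli_of (s q)).
Proof.
(* Summed against [L], this weight gives the trace of [L] times the Pauli string, divided by
   [2 ^ n]. *)
pose w (x y : 'I_(qdim n)) (s : {ffun 'I_n -> 'I_4}) : C :=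
  \prod_q (2^-1 * pauli_mx R (pauli_of (s q)) (bits y q) (bits x q)).
exists (fun s => \sum_x \sum_y L x y * w x y s); apply/matrixP => u v.
rewrite summxE; under eq_bigr do rewrite !mxE mulr_suml.
rewrite exchange_big /=.
(* Exchanging the sum over strings with the product over qubits leaves one completeness relation per
   qubit. *)
have delta x y : \sum_s w x y s *
    (\prod_q pauli_mx R (pauli_of (s q)) (bits u q) (bits v q))
    = ((x == u) && (y == v))%:R.
  under eq_bigr do rewrite -big_split /=.
  rewrite -(bigA_distr_bigA (fun q p => 2^-1 *
    pauli_mx R (pauli_of p) (bits y q) (bits x q) *
    pauli_mx R (pauli_of p) (bits u q) (bits v q))).
  under eq_bigr do rewrite pauli_completeness.
  have [->|xu] := eqVneq x u; last first.
    have /existsP[q /negbTE xq] : [exists q, bits x q != bits u q].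
      apply: contraNT xu; rewrite negb_exists => /forallP xq.
      apply/eqP/(@enum_val_inj _ _); apply/ffunP => q.
      by apply/eqP; rewrite -[_ == _]negbK; exact: xq.
    by rewrite (bigD1 q) //= xq mul0r.
  have [->|yv] := eqVneq y v; last first.
    have /existsP[q /negbTE yq] : [exists q, bits y q != bits v q].
      apply: contraNT yv; rewrite negb_exists => /forallP yq.
      apply/eqP/(@enum_val_inj _ _); apply/ffunP => q.
      by apply/eqP; rewrite -[_ == _]negbK; exact: yq.
    by rewrite (bigD1 q) //= yq andbF mul0r.
  by apply: big1 => q _; rewrite !eqxx.
rewrite (bigD1 u) //= [X in _ + X]big1 => [|x /negbTE xu].
  rewrite addr0; under eq_bigr do rewrite mulr_suml.
  rewrite exchange_big (bigD1 v) //= [X in _ + X]big1 => [|y /negbTE yv].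
    under eq_bigr do rewrite -mulrA.
    by rewrite addr0 -mulr_sumr delta !eqxx mulr1.
  under eq_bigr do rewrite -mulrA.
  by rewrite -mulr_sumr delta yv andbF mulr0.
under eq_bigr do rewrite mulr_suml.
rewrite exchange_big big1 // => y _; under eq_bigr do rewrite -mulrA.
by rewrite -mulr_sumr delta xu mulr0.
Qed.

Definition extend_pauli m n (e : 'I_m -> 'I_n) (s : 'I_m -> pauli) (q : 'I_n) :=
  if [pick j | e j == q] is Some j then s j else PauliI.

Lemma extend_pauli_id m n (e : 'I_m -> 'I_n) s q :
  q \notin codom e -> extend_pauli e s q = PauliI.
Proof.
rewrite /extend_pauli; case: pickP => // j /eqP <-.
by rewrite codom_f.
Qed.

(** The product over qubits splits along [codom e]: inside, injectivity reindexes it by [e];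
    outside, the identity factors multiply to the indicator in [extend_id]. *)
Lemma extend_id_pauli m n (e : 'I_m -> 'I_n) s : injective e ->
  extend_id e (pauli_op R s) = pauli_op R (extend_pauli e s).
Proof.
move=> e_inj; apply/matrixP => x y; rewrite !mxE.
rewrite [RHS](bigID (mem (codom e))) /=; congr (_ * _).
  transitivity (\prod_(q in (e @: 'I_m)%SET)
    pauli_mx R (extend_pauli e s q) (bits x q) (bits y q)).
    rewrite big_imset /=; last by move=> ? ? _ _; exact: e_inj.
    apply: eq_big => // j _.
    rewrite /bits /bindex !enum_rankK !ffunE /extend_pauli.
    by case: pickP => [k /eqP/e_inj -> //|/(_ j)]; rewrite eqxx.
  apply: eq_bigl => q; apply/imsetP/codomP => [[j _ ->]|[j ->]]; by exists j.
under eq_bigr => q qe.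
  rewrite extend_pauli_id //.
  have -> : pauli_mx R PauliI (bits x q) (bits y q) =
      (bits x q == bits y q)%:R.
    by rewrite mxE; case: (bits x q) => [[|[|//]] ?];
      case: (bits y q) => [[|[|//]] ?].
  over.
have [/forallP xy|] := boolP
  [forall q, (q \notin codom e) ==> (bits x q == bits y q)].
  by rewrite big1 // => q qe; have /implyP/(_ qe) -> := xy q.
rewrite negb_forall => /existsP[q]; rewrite negb_imply => /andP[qe /negbTE xy].
by rewrite (bigD1 q) //= xy mul0r.
Qed.

Lemma extend_id_sum m n (e : 'I_m -> 'I_n) (I : finType) (c : I -> C)
    (A : I -> 'M[C]_(qdim m)) :
  extend_id e (\sum_i c i *: A i) = \sum_i c i *: extend_id e (A i).
Proof.
apply/matrixP => x y; rewrite mxE !summxE mulr_suml.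
by apply: eq_bigr => i _; rewrite !mxE mulrA.
Qed.

End TensorAlgebra.

(** * Ancilla coupling and the dissipator *)

Section Dissipators.
Variables (R : realType) (n : nat).
Local Notation C := R[i].
Local Notation M := 'M[C]_n.
Implicit Types (P Q G rho H L : M).

Lemma hess_formC P Q rho H : hess_form P Q rho H = hess_form Q P rho H.
Proof.
by rewrite /hess_form /hess_mx [P *m Q + _]addrC [P *m rho *m Q + _]addrC.
Qed.

Lemma hess_form0l Q rho H : hess_form 0 Q rho H = 0.
Proof.
by rewrite /hess_form /hess_mx !(mul0mx, mulmx0, addr0, scaler0, subr0) mxtrace0.
Qed.

(** Only real scalars pass through the real part; hence the restriction to real combinations of
    generators. *)
Lemma hess_form_linearl (r : R) P P' Q rho H :
  hess_form (r%:C *: P + P') Q rho H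
  = r * hess_form P Q rho H + hess_form P' Q rho H.
Proof.
have ReZD (x y : C) :
    complex.Re (r%:C * x + y) = r * complex.Re x + complex.Re y.
  by case: x y => [? ?] [? ?] /=; rewrite mul0r subr0.
by rewrite /hess_form hess_mx_linearl mulmxDl -scalemxAl mxtraceD mxtraceZ ReZD.
Qed.

Lemma hess_form_suml d (v : 'I_d -> R) (P : 'I_d -> M) Q rho H :
  hess_form (\sum_j (v j)%:C *: P j) Q rho H
  = \sum_j v j * hess_form (P j) Q rho H.
Proof.
elim/big_rec2: _ => [|j x y _ <-]; first exact: hess_form0l.
exact: hess_form_linearl.
Qed.

Lemma hess_form_quadratic d (v : 'rV[R]_d) (P : 'I_d -> M) rho H
    (G := \sum_j (v 0 j)%:C *: P j) :
  (v *m (\matrix_(j, k) hess_form (P j) (P k) rho H) *m v^T) 0 0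
  = hess_form G G rho H.
Proof.
rewrite mxE [RHS]hess_form_suml; apply: eq_bigr => k _.
rewrite hess_formC hess_form_suml !mxE mulrC; congr (_ * _).
by apply: eq_bigr => j _; rewrite mxE.
Qed.

Lemma dissipatorZ L c rho : dissipator L (c *: rho) = c *: dissipator L rho.
Proof.
rewrite /dissipator /anticomm -!scalemxAr -!scalemxAl -scalerDr.
by rewrite scalerBr !scalerA mulrC.
Qed.

(** Supplies the boundedness that [derive1_expsuper] requires. *)
Lemma mxabs_dissipator L :
  exists2 K : R, 0 <= K & forall rho, mxabs (dissipator L rho) <= K * mxabs rho.
Proof.
pose L' := map_mx Num.conj L^T.
exists (mxabs L * mxabs L' + cabs (- 2^-1 : C) *
    (mxabs (L' *m L) + mxabs (L' *m L))).
  by rewrite addr_ge0 // mulr_ge0 ?addr_ge0 ?mxabs_ge0 ?cabs_ge0.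
move=> rho; rewrite /dissipator -/L' -scaleNr mulrDl.
rewrite (le_trans (mxabsD _ _)) // lerD //.
  rewrite (le_trans (mxabsM _ _)) // mulrAC ler_wpM2r ?mxabs_ge0 //.
  exact: mxabsM.
rewrite (le_trans (mxabsZ _ _)) // -mulrA ler_wpM2l ?cabs_ge0 //.
rewrite (le_trans (mxabsD _ _)) // mulrDl lerD ?mxabsM //.
by rewrite mulrC mxabsM.
Qed.

End Dissipators.

Section AncillaCoupling.
Variables (R : realType) (a n : nat).
Local Notation C := R[i].

(** [trace_coupling] at [c = 1/2], where the adjoint hypothesis makes its [L'] the adjoint of
    [L]. *)
Lemma hess_form_coupling (X Y E : 'M[C]_a) (f : 'M[C]_a -> C)
    (L1 L2 rho H : 'M[C]_n) (L := L1 + 'i%R *: L2) (G := X *t L1 + Y *t L2) :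
  (forall A, \tr (E *m A) = f A) ->
  [/\ f (X *m X) = 1, f (X *m Y) = 'i%R, f (Y *m X) = - 'i%R
    & f (Y *m Y) = 1] ->
  map_mx Num.conj L^T = L1 - 'i%R *: L2 ->
  hess_form G G (E *t rho) (1%:M *t H)
  = 2 * complex.Re (\tr (dissipator L rho *m H)).
Proof.
move=> trE fXY L_adj.
have two (x : C) : 2 * complex.Re x = complex.Re (2 * x).
  by case: x => u v /=; ring.
rewrite two /hess_form.
have ii : 'i%R * 'i%R = -1 :> C by rewrite -expr2 sqrCi.
by rewrite (trace_coupling _ _ _ _ _ ii trE fXY) /dissipator L_adj.
Qed.

End AncillaCoupling.

Lemma adjacent_sites_inj m n (e : 'I_m -> 'I_n) :
  adjacent_sites e -> injective e.
Proof.
move=> [i ei] j k /(congr1 (@nat_of_ord n)); rewrite !ei => /addnI.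
exact: val_inj.
Qed.

(** * Adjoints and real combinations of operators *)

Section Adjoints.
Variables (R : realType) (n : nat).
Local Notation C := R[i].
Implicit Type A : 'M[C]_n.

Lemma adjointE A x y :
  map_mx Num.conj A^T = A -> Num.conj (A y x) = A x y.
Proof. by move=> {2}<-; rewrite !mxE. Qed.

Lemma adjoint_real_comb (I : finType) (r : I -> R) (A : I -> 'M[C]_n) :
  (forall i, map_mx Num.conj (A i)^T = A i) ->
  map_mx Num.conj (\sum_i (r i)%:C *: A i)^T = \sum_i (r i)%:C *: A i.
Proof.
move=> adjA; apply/matrixP => x y; rewrite !mxE !summxE rmorph_sum.
apply: eq_bigr => i _; rewrite !mxE rmorphM.
by congr (_ * _); [exact: conjc_real | exact: adjointE].
Qed.

Lemma adjointD_i A B :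
  map_mx Num.conj A^T = A -> map_mx Num.conj B^T = B ->
  map_mx Num.conj (A + 'i%R *: B)^T = A - 'i%R *: B.
Proof.
move=> adjA adjB; apply/matrixP => x y; rewrite !mxE rmorphD rmorphM.
rewrite -mulNr; congr (_ + _ * _); first exact: adjointE.
  exact: conjCi.
exact: adjointE.
Qed.

End Adjoints.

Section RealSpan.
Variables (R : realType) (d m n : nat) (P : 'I_d -> 'M[R[i]]_(m, n)).

(** The coefficients form a row vector because they serve as the test vector for the Hessian. *)
Definition real_span (G : 'M[R[i]]_(m, n)) : Prop :=
  exists v : 'rV[R]_d, G = \sum_j (v 0 j)%:C *: P j.

Lemma real_spanD G G' : real_span G -> real_span G' -> real_span (G + G').
Proof.
move=> [v ->] [v' ->]; exists (v + v'); rewrite -big_split.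
by apply: eq_bigr => j _; rewrite mxE rmorphD scalerDl.
Qed.

Lemma real_spanZ (r : R) j : real_span (r%:C *: P j).
Proof.
exists (r *: 'e_j); rewrite (bigD1 j) //= !mxE !eqxx mulr1 big1 ?addr0 //.
by move=> k /negbTE kj; rewrite !mxE kj andbF mulr0 scale0r.
Qed.

Lemma real_span_sum (I : Type) (r : seq I) (F : I -> 'M[R[i]]_(m, n)) :
  (forall i, real_span (F i)) -> real_span (\sum_(i <- r) F i).
Proof.
move=> FP; apply: big_ind => //; last exact: real_spanD.
by exists 0; rewrite big1 // => j _; rewrite mxE scale0r.
Qed.

End RealSpan.

Theorem lemma2 (R : realType) (N a k d : nat)
  (rho H : 'M[R[i]]_(qdim N))
  (GA GS : seq 'M[R[i]]_(qdim a * qdim N))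
  (P : 'I_d -> 'M[R[i]]_(qdim a * qdim N))
  (rho_density : density_op rho)
  (H_herm : H \is hermsymmx)
  (a_gt0 : (0 < a)%N)
  (k_bounds : (1 <= k - 1 <= N)%N)
  (P_inj : injective P)
  (P_enum : forall M, (exists j, P j = M) <-> (M \in GA) \/ (M \in GS))
  (P_herm : forall j, P j \is hermsymmx)
  (GS_on_S : forall M : 'M[R[i]]_(qdim a * qdim N), M \in GS ->
     exists M0 : 'M[R[i]]_(qdim N), M = 1%:M *t M0)
  (GA_pauli : forall (e : 'I_(k - 1) -> 'I_N) (s : 'I_N -> pauli) (q : 'I_a),
     adjacent_sites e -> (forall j, j \notin codom e -> s j = PauliI) ->
     (pauli_at R PauliX q *t pauli_op R s \in GA) /\
     (pauli_at R PauliY q *t pauli_op R s \in GA))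
  (e : 'I_(k - 1) -> 'I_N) (L0 : 'M[R[i]]_(qdim (k - 1))) :
  adjacent_sites e ->
  let E := energy P (proj0 R a *t rho) (1%:M *t H) in
  let K := hessian E 0 in
  let L := extend_id e L0 in
  psdmx idfun K ->
  0 <= derive1 (fun t : R => complex.Re (\tr
         (expsuper (fun sigma => t%:C *: dissipator L sigma) rho *m H))) 0.
Proof.
move=> e_adj E K L [_ K_ge0].
have [K' K'0 bndL] := mxabs_dissipator L.
(* The goal becomes nonnegativity of the real part of the trace of [dissipator L rho *m H]. *)
rewrite (derive1_expsuper rho H K'0 (dissipatorZ L) bndL).
have [c L0E] := pauli_decomposition L0.
pose Ps (s : {ffun 'I_(k - 1) -> 'I_4}) : 'M[R[i]]_(qdim N) :=
  pauli_op R (extend_pauli e (fun j => pauli_of (s j))).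
have LE : L = \sum_s c s *: Ps s.
  rewrite /L L0E extend_id_sum; apply: eq_bigr => s _.
  by rewrite extend_id_pauli //; exact: adjacent_sites_inj.
(* Pauli operators are hermitian, so real coefficients make [L1] and [L2] hermitian and the adjoint
   of [L] equal to [L1 - 'i *: L2]. *)
pose L1 := \sum_s (complex.Re (c s))%:C *: Ps s.
pose L2 := \sum_s (complex.Im (c s))%:C *: Ps s.
have LRI : L = L1 + 'i%R *: L2.
  rewrite LE /L1 /L2 scaler_sumr -big_split; apply: eq_bigr => s _ /=.
  by rewrite scalerA -scalerDl -complexiE -complexE.
have adjPs s : map_mx Num.conj (Ps s)^T = Ps s by exact: adjoint_pauli_op.
have L_adj : map_mx Num.conj (L1 + 'i%R *: L2)^T = L1 - 'i%R *: L2.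
  by apply: adjointD_i; exact: adjoint_real_comb.
(* One ancilla qubit suffices for the coupling; the first is taken. *)
pose q := Ordinal a_gt0.
pose X := pauli_at R PauliX q; pose Y := pauli_at R PauliY q.
have PsP s : (exists j, P j = X *t Ps s) /\ (exists j, P j = Y *t Ps s).
  have [|XG YG] := GA_pauli e (extend_pauli e (fun j => pauli_of (s j))) q e_adj.
    exact: extend_pauli_id.
  by split; apply/P_enum; left.
have [v Gv] : real_span P (X *t L1 + Y *t L2).
  apply: real_spanD; rewrite tensmx_sumr; apply: real_span_sum => s;
    rewrite tensmxZr; have [[j Pj] [j' Pj']] := PsP s.
  - by rewrite -Pj; exact: real_spanZ.
  - by rewrite -Pj'; exact: real_spanZ.
(* Positivity is tested on the coefficients of the coupling; for [idfun] the conjugate transpose is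
   the transpose. *)
have := K_ge0 v; rewrite map_mx_id //.
have -> : K = \matrix_(j, l) hess_form (P j) (P l) (proj0 R a *t rho) (1%:M *t H).
  by apply/matrixP => j l; rewrite [RHS]mxE; exact: hessian_energy.
rewrite hess_form_quadratic -Gv.
pose z : 'I_(qdim a) := bindex [ffun=> ord0].
(* The functional [f] is the expectation in the all-zero ancilla state; a factor 2 then cancels. *)
rewrite (hess_form_coupling _ _ (f := fun A => A z z)) //.
- by rewrite -LRI pmulr_rge0.
- exact: tr_proj0.
- by rewrite !pauli_at_mul00; exact: pauli_XY00.
Qed.
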